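(* Let $a<b$ be real numbers, let $\alpha\in(0,1)$, and let $k:[a,b]\to\mathbb{R}$ be a continuous nonnegative function such that $k(t)\neq 0$ whenever $t>a$. Let $f:[a,b]\to\mathbb{R}$ be a function and let $t\in[a,b]$ with $t>a$. Then $f$ is $\alpha$-differentiable at $t$ with respect to the kernel $k$ if and only if $f$ is differentiable at $t$ (in the usual sense). In that case, $$f^{(\alpha)}(t)=k(t)^{1-\alpha}f'(t).$$
   Context: Let $k:[a,b]\to\mathbb{R}$ be a continuous nonnegative function with $k(t)\neq0$ whenever $t>a$ (the kernel), and let $\alpha\in(0,1)$. A function $f:[a,b]\to\mathbb{R}$ is called $\alpha$-differentiable at $t>a$ with respect to the kernel $k$ if the limit $$f^{(\alpha)}(t):=\lim_{\epsilon\to0}\frac{f\left(t+\epsilon\, k(t)^{1-\alpha}\right)-f(t)}{\epsilon}$$ exists (as a real number); $f^{(\alpha)}(t)$ is then called the $\alpha$-derivative of $f$ at $t$. Limits are taken over those increments for which the argument of $f$ lies in $[a,b]$; in particular, at $t=b$ both the limit above and the ordinary derivative $f'(b)$ are understood as one-sided. *)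

(* Defs.v *)
From mathcomp Require Import all_boot all_order all_algebra.
From mathcomp Require Import all_classical all_reals all_analysis.
From mathcomp Require Import lra.

Set Implicit Arguments.
Unset Strict Implicit.
Unset Printing Implicit Defensive.

Import Order.TTheory GRing.Theory Num.Theory.
Import numFieldNormedType.Exports.

Local Open Scope classical_set_scope.
Local Open Scope ring_scope.

(* Functions on [a, b] are total functions R -> R of which only the values on
   [a, b] are used: every limit below is along the nonzero increments e -> 0
   for which the argument t + e * c of f stays in [a, b]. *)
Definition admissible_increments (R : realType) (a b t c : R) : set_system R :=
  within [set e : R | a <= t + e * c <= b] 0^'.

Definition alpha_quotient (R : realType) (k : R -> R) (alpha : R)
    (f : R -> R) (t e : R) : R :=
  (f (t + e * k t `^ (1 - alpha)) - f t) / e.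

Definition alpha_differentiable (R : realType) (a b : R) (k : R -> R)
    (alpha : R) (f : R -> R) (t : R) : Prop :=
  cvg (alpha_quotient k alpha f t e
         @[e --> admissible_increments a b t (k t `^ (1 - alpha))]).

Definition alpha_derivative (R : realType) (a b : R) (k : R -> R)
    (alpha : R) (f : R -> R) (t : R) : R :=
  lim (alpha_quotient k alpha f t e
         @[e --> admissible_increments a b t (k t `^ (1 - alpha))]).

(* The library's [derivable] and [derive1] are two-sided, hence unsuitable at
   the endpoints of [a, b]; they agree with the notions below in the interior
   ([differentiable_in_interior], [derivative_in_interior]). *)
Definition differentiable_in (R : realType) (a b : R) (f : R -> R) (t : R) :
    Prop :=
  cvg ((f (t + h) - f t) / h @[h --> admissible_increments a b t 1]).

Definition derivative_in (R : realType) (a b : R) (f : R -> R) (t : R) : R :=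
  lim ((f (t + h) - f t) / h @[h --> admissible_increments a b t 1]).

Lemma admissible_increments_interior (R : realType) (a b t : R) :
  a < t < b -> admissible_increments a b t 1 = 0^'.
Proof.
move=> /andP[at_ tb]; rewrite /admissible_increments.
have near_ab : \forall h \near (0 : R)^', a <= t + h * 1 <= b.
  apply: nbhs_dnbhs.
  have d0 : 0 < Num.min (t - a) (b - t) by rewrite lt_min !subr_gt0 at_.
  near=> h.
  have : `|h| < Num.min (t - a) (b - t).
    by near: h; exact: (@nbhs0_lt _ R^o).
  rewrite lt_min !ltr_norml => /andP[/andP[h1 _] /andP[_ h2]].
  by apply/andP; split; lra.
apply/seteqP; split => A; rewrite /within /=.
- by move=> hA; apply: filterS2 near_ab hA => h /[swap]; apply.
- by apply: filterS => h.
Unshelve. all: by end_near. Qed.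

Lemma admissible_increments_right_end (R : realType) (a b : R) :
  a < b -> admissible_increments a b b 1 = 0^'-.
Proof.
move=> ab; rewrite /admissible_increments.
have near_a : \forall h \near (0 : R), a <= b + h * 1.
  near=> h.
  have : `|h| < b - a by near: h; apply: (@nbhs0_lt _ R^o); rewrite subr_gt0.
  by rewrite ltr_norml mulr1 => /andP[h1 _]; lra.
apply/seteqP; split => A; rewrite /at_left /dnbhs /within /=.
- move=> hA; apply: filterS2 near_a hA => h ah hA h0.
  by apply: hA; rewrite ?lt_eqF// ah/= mulr1 gerDl ltW.
- apply: filterS => h hA h0 /andP[_]; rewrite mulr1 gerDl => hle.
  by apply: hA; rewrite lt_neqAle h0.
Unshelve. all: by end_near. Qed.

Lemma differentiable_in_interior (R : realType) (a b : R) (f : R -> R)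
    (t : R) :
  a < t < b -> differentiable_in a b f t <-> derivable f t 1.
Proof.
move=> atb; rewrite /differentiable_in /derivable.
rewrite admissible_increments_interior//.
suff -> : (fun h => (f (t + h) - f t) / h) =
  (fun h => h^-1 *: ((f \o shift t) (h *: 1) - f t)) by [].
by apply/funext => h; rewrite /= /GRing.scale /= mulr1 mulrC (addrC t).
Qed.

Lemma derivative_in_interior (R : realType) (a b : R) (f : R -> R) (t : R) :
  a < t < b -> derivative_in a b f t = derive1 f t.
Proof.
move=> atb; rewrite /derivative_in derive1E /derive.
rewrite admissible_increments_interior//.
suff -> : (fun h => (f (t + h) - f t) / h) =
  (fun h => h^-1 *: ((f \o shift t) (h *: 1) - f t)) by [].
by apply/funext => h; rewrite /= /GRing.scale /= mulr1 mulrC (addrC t).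
Qed.

(* Main.v *)
Require Import Defs.
From mathcomp Require Import all_boot all_order all_algebra.
From mathcomp Require Import all_classical all_reals all_analysis.
From mathcomp Require Import lra.
Import Order.TTheory GRing.Theory Num.Theory.
Import numFieldNormedType.Exports.
Local Open Scope classical_set_scope.
Local Open Scope ring_scope.

(** The alpha-quotient is an ordinary difference quotient taken along a
    rescaled increment: since [t > a], the factor [c = k t `^ (1 - alpha)] is
    a fixed positive number, and [h = e * c] turns
    [(f (t + e * c) - f t) / e] into [c * ((f (t + h) - f t) / h)].
    Multiplication by a nonzero number is a bijection between the admissible
    increments for the two quotients, compatible with their convergence to 0
    ([cvg_admissible_increments_scale]), so a limit [l] of one quotient gives
    the limit of the other ([cvg_quotient_scale]); rescaling by [c] proves one
    implication and rescaling by [c^-1] the other. The values of the limits can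
    be compared because limits along admissible increments are unique: there
    are arbitrarily small nonzero ones, as [t] can be approached from the left
    within [a, b] ([admissible_increments_proper]). *)

Instance admissible_increments_filter (R : realType) (a b t c : R) :
  Filter (admissible_increments a b t c).
Proof. by rewrite /admissible_increments; exact: within_filter. Qed.

Lemma cvg_admissible_increments_scale (R : realType) (a b t c d : R) :
  d != 0 ->
  e * d @[e --> admissible_increments a b t (d * c)] -->
    admissible_increments a b t c.
Proof.
move=> d0 A; rewrite /admissible_increments /within /= => hA.
have scale0 : e * d @[e --> (0 : R)^'] --> (0 : R)^'.
  move=> B; rewrite /dnbhs /within /= => hB.
  have scale00 : e * d @[e --> (0 : R)] --> (0 : R).
    by rewrite -[X in _ --> X](mul0r d); apply: cvgMr_tmp; exact: cvg_id.
  have := scale00 _ hB; apply: (@filterS _ (nbhs (0 : R))) => e /= + e0; apply.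
  by rewrite mulf_neq0.
by have := scale0 _ hA; apply: (@filterS _ (0 : R)^') => e /=; rewrite -mulrA.
Qed.

(** The case of a general [c], rather than [c = 1], makes the lemma apply in
    both directions: [d] and [d^-1] undo each other. *)
Lemma cvg_quotient_scale (R : realType) (a b t c d l : R) (f : R -> R) :
  d != 0 ->
  (f (t + e * c) - f t) / e @[e --> admissible_increments a b t c] --> l ->
  (f (t + e * (d * c)) - f t) / e
    @[e --> admissible_increments a b t (d * c)] --> d * l.
Proof.
move=> d0 ql.
have -> : (fun e => (f (t + e * (d * c)) - f t) / e) =
          (fun e => d * ((f (t + e * d * c) - f t) / (e * d))).
  apply/funext => e; rewrite mulrA invfM mulrCA; congr (_ * _).
  by rewrite mulrCA mulfV// mulr1.
apply: cvgMl_tmp.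
exact: cvg_comp (cvg_admissible_increments_scale _ _ _ _ c _ d0) ql.
Qed.

(** Limits along this filter are unique: as [a < t], every small negative [h]
    is an admissible increment for the factor 1, and dividing these [h] by [c]
    settles the general case. *)
Lemma admissible_increments_proper (R : realType) (a b t c : R) :
  a < t <= b -> c != 0 -> ProperFilter (admissible_increments a b t c).
Proof.
move=> /andP[at_ tb] c0.
have left_admissible : (0 : R)^'- `=>` admissible_increments a b t 1.
  rewrite /admissible_increments => A; rewrite /dnbhs /within /= => hA.
  have {}hA : \forall h \near (0 : R)^'-,
      h != 0 -> a <= t + h * 1 <= b -> A h.
    by apply: (@filterS _ (nbhs (0 : R)) _ _ _ _ hA) => h + _.
  have left_a : \forall h \near (0 : R)^'-, a - t < h.
    by apply: nbhs_left_gt; rewrite subr_lt0.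
  have left_0 : \forall h \near (0 : R)^'-, h < 0 by exact: nbhs_left_lt.
  apply: filterS3 hA left_a left_0 => h + ath h0; rewrite mulr1; apply.
    by rewrite lt_eqF.
  by apply/andP; split; lra.
split; last exact: admissible_increments_filter.
have cV0 : c^-1 != 0 by rewrite invr_eq0.
move=> empty_admissible.
have := @cvg_admissible_increments_scale _ a b t c _ cV0 _ empty_admissible.
by rewrite mulVf// => /left_admissible; exact: filter_not_empty.
Qed.

Theorem theorem3 (R : realType) (a b alpha : R) (k f : R -> R) (t : R)
    (hab : a < b) (halpha : 0 < alpha < 1)
    (kcont : {within `[a, b], continuous k})
    (kge0 : forall x : R, a <= x <= b -> 0 <= k x)
    (kneq0 : forall x : R, a < x <= b -> k x <> 0)
    (ht : a < t <= b) :
  (alpha_differentiable a b k alpha f t <-> differentiable_in a b f t) /\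
  (alpha_differentiable a b k alpha f t ->
   alpha_derivative a b k alpha f t =
     k t `^ (1 - alpha) * derivative_in a b f t).
Proof.
rewrite /alpha_differentiable /alpha_derivative /alpha_quotient.
rewrite /differentiable_in /derivative_in.
have kt_gt0 : 0 < k t.
  rewrite lt_neqAle eq_sym; apply/andP; split; first exact/eqP/kneq0.
  by case/andP: ht => at_ tb; apply: kge0; rewrite ltW.
set c := k t `^ (1 - alpha).
have c0 : c != 0 by rewrite gt_eqF// powR_gt0.
pose q x e := (f (t + e * x) - f t) / e.
have q1 : (fun h => (f (t + h) - f t) / h) = q 1.
  by apply/funext => h; rewrite /q mulr1.
rewrite q1 -/(q c).
have ordinary_to_alpha l : q 1 e @[e --> admissible_increments a b t 1] --> l ->
    q c e @[e --> admissible_increments a b t c] --> c * l.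
  by move=> /(cvg_quotient_scale _ _ _ _ _ _ _ _ c0); rewrite mulr1.
have alpha_to_ordinary l : q c e @[e --> admissible_increments a b t c] --> l ->
    q 1 e @[e --> admissible_increments a b t 1] --> c^-1 * l.
  have cV0 : c^-1 != 0 by rewrite invr_eq0.
  by move=> /(cvg_quotient_scale _ _ _ _ _ _ _ _ cV0); rewrite mulVf.
have proper1 := admissible_increments_proper _ _ _ _ _ ht (oner_neq0 R).
have properc := admissible_increments_proper _ _ _ _ _ ht c0.
split; first by split=> /cvg_ex[l ql]; apply/cvg_ex; eexists;
  [exact: alpha_to_ordinary ql | exact: ordinary_to_alpha ql].
move=> /alpha_to_ordinary q1l.
have qcl := ordinary_to_alpha _ q1l.
by rewrite (cvg_lim (@Rhausdorff R) qcl) (cvg_lim (@Rhausdorff R) q1l).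
Qed.
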